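(* Let $(U,\{e_i\}_{i\in I})$ and $(T,\{f_j\}_{j\in J})$ be basic $\mathbb{K}$-algebras with enough idempotents, and let $M$ be a $U$-$T$-bimodule on which $\mathbb{K}$ acts centrally, such that $e_iMf_j$ is a $\mathbb{K}$-module of finite length for all $(i,j)\in I\times J$. Let $\tilde{\mathcal{A}}=\{\tilde{\mathcal{A}}_i\}_{i<\alpha}$ be a partition of $I$, $\tilde{\mathcal{B}}=\{\tilde{\mathcal{B}}_j\}_{j<\beta}$ a partition of $J$, and $\tilde{\mathcal{C}}:=\tilde{\mathcal{A}}\vee\tilde{\mathcal{B}}$ the joint partition of the disjoint union $I\vee J$. Let $\Lambda:=\begin{bmatrix}T&0\\ M&U\end{bmatrix}$ be the lower triangular matrix $\mathbb{K}$-algebra, with its idempotents $\{g_r\}_{r\in I\vee J}$. Then the following statements are equivalent. (a) $(\Lambda,\tilde{\mathcal{C}})$ is a left standardly stratified $\mathbb{K}$-algebra. (b) $Mf_j\in\mathcal{F}_f({}_{\tilde{\mathcal{A}}}\Delta)$ for every $j\in J$, and the pairs $(T,\tilde{\mathcal{B}})$ and $(U,\tilde{\mathcal{A}})$ are left standardly stratified $\mathbb{K}$-algebras.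
   Context: $\mathbb{K}$ is a fixed commutative ring with unity. Rings and algebras are associative but need not have a unity. A $\mathbb{K}$-algebra with enough idempotents (w.e.i. $\mathbb{K}$-algebra) is a pair $(R,\{e_i\}_{i\in I})$ with $R$ a $\mathbb{K}$-algebra and $\{e_i\}_{i\in I}$ a family of orthogonal idempotents of $R$ such that $R=\bigoplus_{i\in I}e_iR=\bigoplus_{i\in I}Re_i$. $\mathrm{Mod}(R)$ is the category of unitary left $R$-modules ($N$ with $RN=N$). The algebra is basic if every $e_jRe_i$ is a $\mathbb{K}$-module of finite length (Hom-finite), each $e_i$ is primitive, and $Re_i\not\simeq Re_j$ for $e_i\neq e_j$. Bimodules are unitary: $UM=M=MT$. The index sets $I,J$ are nonempty. Triangular algebra: $\Lambda$ consists of the matrices $\begin{bmatrix}t&0\\ m&u\end{bmatrix}$ ($t\in T$, $m\in M$, $u\in U$) with entrywise sum and product $\begin{bmatrix}t&0\\ m&u\end{bmatrix}\begin{bmatrix}t'&0\\ m'&u'\end{bmatrix}=\begin{bmatrix}tt'&0\\ mt'+um'&uu'\end{bmatrix}$. The disjoint union is $I\vee J=(I\times\{1\})\cup(J\times\{2\})$; set $g_{(i,1)}=\overline{e}_i:=\begin{bmatrix}0&0\\0&e_i\end{bmatrix}$ and $g_{(j,2)}=\overline{f}_j:=\begin{bmatrix}f_j&0\\0&0\end{bmatrix}$. Under the stated hypotheses $(\Lambda,\{g_r\}_{r\in I\vee J})$ is a basic w.e.i. $\mathbb{K}$-algebra. Partitions: partitions are indexed by ordinals. The joint partition $\tilde{\mathcal{A}}\vee\tilde{\mathcal{B}}$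 of $I\vee J$ is indexed by the well-ordered set $[0,\alpha)\vee[0,\beta)$, in which every element of $[0,\alpha)\times\{1\}$ precedes every element of $[0,\beta)\times\{2\}$ (order type $\alpha+\beta$), and $(\tilde{\mathcal{A}}\vee\tilde{\mathcal{B}})_{(i,1)}=\tilde{\mathcal{A}}_i\times\{1\}$, $(\tilde{\mathcal{A}}\vee\tilde{\mathcal{B}})_{(j,2)}=\tilde{\mathcal{B}}_j\times\{2\}$. Standard modules: for a basic w.e.i. $\mathbb{K}$-algebra $(R,\{e_i\}_{i\in I})$ and a partition $\tilde{\mathcal{A}}=\{\tilde{\mathcal{A}}_i\}_{i<\alpha}$ of $I$, for $t\in\tilde{\mathcal{A}}_i$ put $P_t(i)={}_{\tilde{\mathcal{A}}}P_t(i):=Re_t$, $\overline{P}(j):=\bigoplus_{r\in\tilde{\mathcal{A}}_j}P_r(j)$, and $\Delta_t(i)={}_{\tilde{\mathcal{A}}}\Delta_t(i):=P_t(i)/\mathrm{Tr}_{\bigoplus_{j<i}\overline{P}(j)}(P_t(i))$, where $\mathrm{Tr}_X(N)$ is the sum of the images of all morphisms $X\to N$. Put $\Delta(i)=\{\Delta_t(i)\}_{t\in\tilde{\mathcal{A}}_i}$ and ${}_{\tilde{\mathcal{A}}}\Delta=\bigcup_{i<\alpha}\Delta(i)$. For a class $\Theta$ of modules, $\mathcal{F}_f(\Theta)$ is the class of $N\in\mathrm{Mod}(R)$ having a finite chain of submodules $0=N_0\subseteq N_1\subseteq\dots\subseteq N_n=N$ with each $N_k/N_{k-1}$ isomorphic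 to an object of $\Theta$. The pair $(R,\tilde{\mathcal{A}})$ is a left standardly stratified $\mathbb{K}$-algebra if $\mathrm{Tr}_{\bigoplus_{j<i}\overline{P}(j)}(P_t(i))\in\mathcal{F}_f(\bigcup_{j<i}\Delta(j))$ for all $i<\alpha$ and $t\in\tilde{\mathcal{A}}_i$. *)

(* Defs.v *)
From HB Require Import structures.
From mathcomp Require Import all_boot all_order all_algebra.
From mathcomp Require Import boolp classical_sets functions cardinality wochoice.

Set Implicit Arguments.
Unset Strict Implicit.
Unset Printing Implicit Defensive.

Import GRing.Theory.
Local Open Scope classical_set_scope.
Local Open Scope ring_scope.

Record nalg (K : comPzRingType) := NAlg {
  nalg_sort :> lmodType K;
  nmul : nalg_sort -> nalg_sort -> nalg_sort;
  nmulA : forall x y z, nmul x (nmul y z) = nmul (nmul x y) z;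
  nmulPl : forall (a : K) x y z,
    nmul (a *: x + y) z = a *: nmul x z + nmul y z;
  nmulPr : forall (a : K) x y z,
    nmul z (a *: x + y) = a *: nmul z x + nmul z y }.

Declare Scope nalg_scope.
Local Open Scope nalg_scope.
Notation "x ** y" := (nmul x y) (at level 40, left associativity) : nalg_scope.

(* Left modules are not assumed unitary: see [unitary]. *)
Record lmodule (K : comPzRingType) (R : nalg K) := LModule {
  lm_sort :> zmodType;
  act : R -> lm_sort -> lm_sort;
  actDl : forall r s n, act (r + s) n = act r n + act s n;
  actDr : forall r n p, act r (n + p) = act r n + act r p;
  actM : forall r s n, act (r ** s) n = act r (act s n) }.

Section Modules.
Variables (K : comPzRingType) (R : nalg K).
Implicit Types N X : lmodule R.

Definition unitary N := forall n : N,
  exists p (r : 'I_p -> R) (y : 'I_p -> N), n = \sum_k act (r k) (y k).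

Definition lhom X N (h : X -> N) :=
  zmod_morphism h /\ forall r x, h (act r x) = act r (h x).

Definition lmod_iso X N := exists h : X -> N, lhom h /\ bijective h.

Lemma act0 N (r : R) : act r (0 : N) = 0.
Proof. by apply: (@addrI N (act r 0)); rewrite -actDr !addr0. Qed.

Lemma actN N (r : R) (x : N) : act r (- x) = - act r x.
Proof. by apply: (@addrI N (act r x)); rewrite -actDr !subrr act0. Qed.

Lemma actB N (r : R) (x y : N) : act r (x - y) = act r x - act r y.
Proof. by rewrite actDr actN. Qed.

Lemma act_sum N (r : R) n (y : 'I_n -> N) :
  act r (\sum_k y k) = \sum_k act r (y k).
Proof. exact: (big_morph _ (actDr r) (act0 N r)). Qed.

Definition is_submod N (S : set N) :=
  [/\ S 0, (forall x y, S x -> S y -> S (x - y))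
    & forall r x, S x -> S (act r x)].

Record submod N := Submod { sm_set :> set N; submodP : is_submod sm_set }.

Section SubAndQuotient.
Variables (N : lmodule R) (S : submod N).

Definition sm_pred : {pred N} := fun x => `[< sm_set S x >].

Lemma sm_pred_zmod : zmod_closed sm_pred.
Proof.
have [S0 SB _] := submodP S.
split=> [|x y /asboolP Sx /asboolP Sy]; apply/asboolP => //.
exact: SB.
Qed.

HB.instance Definition _ := GRing.isZmodClosed.Build N sm_pred sm_pred_zmod.

Record sm_type := SmType { sm_val : N; sm_valP : sm_val \in sm_pred }.
HB.instance Definition _ := [isSub for sm_val].
HB.instance Definition _ := [Choice of sm_type by <:].
HB.instance Definition _ := [SubChoice_isSubZmodule of sm_type by <:].

Lemma sm_pred_act (r : R) (x : sm_type) : act r (sm_val x) \in sm_pred.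
Proof.
have [_ _ SM] := submodP S.
by apply/asboolP; apply: SM; apply/asboolP; exact: sm_valP.
Qed.

Definition sm_act (r : R) (x : sm_type) : sm_type := SmType (sm_pred_act r x).

Lemma sm_actDl r s x : sm_act (r + s) x = sm_act r x + sm_act s x.
Proof. by apply: val_inj => /=; rewrite actDl. Qed.

Lemma sm_actDr r x y : sm_act r (x + y) = sm_act r x + sm_act r y.
Proof. by apply: val_inj => /=; rewrite actDr. Qed.

Lemma sm_actM r s x : sm_act (r ** s) x = sm_act r (sm_act s x).
Proof. by apply: val_inj => /=; rewrite actM. Qed.

Definition sub_module : lmodule R := LModule sm_actDl sm_actDr sm_actM.

Local Notation Q := (Quotient.quot sm_pred).

Definition quot_act (r : R) (x : Q) : Q := \pi_Q%qT (act r (repr x)).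

Lemma quot_act_pi r (x : N) : quot_act r (\pi_Q%qT x) = \pi_Q%qT (act r x).
Proof.
apply/eqP; rewrite /quot_act -Quotient.idealrBE -actB.
have [_ _ SM] := submodP S.
apply/asboolP; apply: SM; apply/asboolP.
by have := Quotient.idealrBE sm_pred (repr (\pi_Q%qT x)) x; rewrite reprK eqxx.
Qed.

Lemma quot_actDl r s x : quot_act (r + s) x = quot_act r x + quot_act s x.
Proof. by rewrite /quot_act actDl raddfD. Qed.

Lemma quot_actDr r x y : quot_act r (x + y) = quot_act r x + quot_act r y.
Proof.
rewrite -[x]reprK -[y]reprK -raddfD !quot_act_pi actDr; exact: raddfD.
Qed.

Lemma quot_actM r s x : quot_act (r ** s) x = quot_act r (quot_act s x).
Proof. by rewrite {1}/quot_act actM -!quot_act_pi reprK. Qed.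

Definition quot_module : lmodule R := LModule quot_actDl quot_actDr quot_actM.

End SubAndQuotient.

(* [subquot A B] is A / (A :&: B), i.e. A / B when B is contained in A. *)
Section Restriction.
Variables (N : lmodule R) (A B : submod N).

Lemma restr_submod_subproof :
  is_submod [set x : sub_module A | sm_set B (sm_val x)].
Proof. by have [B0 BB BM] := submodP B; split=> //= *; [apply: BB|apply: BM]. Qed.

Definition restr_submod : submod (sub_module A) := Submod restr_submod_subproof.

Definition subquot : lmodule R := quot_module restr_submod.
End Restriction.

Section DirectSum.
Variables (X : Type) (F : X -> lmodule R).

Definition dprod := forall x, F x.
HB.instance Definition _ := gen_eqMixin dprod.
HB.instance Definition _ := gen_choiceMixin dprod.

Let pzero : dprod := fun=> 0.
Let popp (u : dprod) : dprod := fun x => - u x.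
Let padd (u v : dprod) : dprod := fun x => u x + v x.
Let paddA : associative padd.
Proof. by move=> u v w; apply: functional_extensionality_dep => x; apply: addrA. Qed.
Let paddC : commutative padd.
Proof. by move=> u v; apply: functional_extensionality_dep => x; apply: addrC. Qed.
Let padd0 : left_id pzero padd.
Proof. by move=> u; apply: functional_extensionality_dep => x; apply: add0r. Qed.
Let paddN : left_inverse pzero popp padd.
Proof. by move=> u; apply: functional_extensionality_dep => x; apply: addNr. Qed.
HB.instance Definition _ := GRing.isZmodule.Build dprod paddA paddC padd0 paddN.

Let pact (r : R) (u : dprod) : dprod := fun x => act r (u x).
Let pactDl r s u : pact (r + s) u = pact r u + pact s u.
Proof. by apply: functional_extensionality_dep => x; apply: actDl. Qed.
Let pactDr r u v : pact r (u + v) = pact r u + pact r v.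
Proof. by apply: functional_extensionality_dep => x; apply: actDr. Qed.
Let pactM r s u : pact (r ** s) u = pact r (pact s u).
Proof. by apply: functional_extensionality_dep => x; apply: actM. Qed.

Definition dprod_module : lmodule R := LModule pactDl pactDr pactM.

Lemma dsum_subproof :
  is_submod [set u : dprod_module | finite_set [set x | u x <> 0]].
Proof.
split=> /=.
- by apply: (sub_finite_set _ (@finite_set0 X)) => x /=.
- move=> u v fu fv.
  apply: (sub_finite_set _ (_ : finite_set ([set x | u x <> 0]
                                       `|` [set x | v x <> 0]))).
    move=> x /= uv; apply: contrapT => /not_orP[/contrapT u0 /contrapT v0].
    by apply: uv; rewrite -[LHS]/(u x - v x) u0 v0 subr0.
  by rewrite finite_setU.
- move=> r u fu; apply: (sub_finite_set _ fu) => x /= ru u0; apply: ru.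
  by rewrite -[LHS]/(act r (u x)) u0 act0.
Qed.

Definition dsum : lmodule R := sub_module (Submod dsum_subproof).

End DirectSum.

Section Trace.
Variables X N : lmodule R.

Lemma trace_subproof : is_submod [set n : N |
  exists p (h : 'I_p -> X -> N) (y : 'I_p -> X),
    (forall k, lhom (h k)) /\ n = \sum_k h k (y k)].
Proof.
split=> /=.
- exists 0%N, (fun _ _ => 0), (fun=> 0).
  by split=> [[]//|]; rewrite big_ord0.
- move=> _ _ [p [h [y [hh ->]]]] [q [g [z [hg ->]]]].
  exists (p + q)%N.
  exists (fun k => match fintype.split k with inl i => h i | inr j => g j end).
  exists (fun k => match fintype.split k with inl i => y i | inr j => - z j end).
  split; first by move=> k; case: fintype.split.
  rewrite big_split_ord /= -sumrN; congr (_ + _); apply: eq_bigr => k _.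
    by rewrite -[lshift q k]/(unsplit (inl k)) unsplitK.
  rewrite -[rshift p k]/(unsplit (inr k)) unsplitK.
  have [gB _] := hg k.
  have g0 : g k 0 = 0 by rewrite -(subrr 0) gB subrr.
  by rewrite -[- z k]sub0r gB g0 sub0r.
- move=> r _ [p [h [y [hh ->]]]].
  exists p, h, (fun k => act r (y k)); split=> //.
  by rewrite act_sum; apply: eq_bigr => k _; rewrite (hh k).2.
Qed.

Definition trace : submod N := Submod trace_subproof.
End Trace.

Definition Ff (Theta : lmodule R -> Prop) N :=
  unitary N /\
  exists n (c : nat -> submod N),
    [/\ sm_set (c 0%N) = [set 0], sm_set (c n) = [set: N]
      & forall k, (k < n)%N -> c k `<=` c k.+1 /\
          exists2 X, Theta X & lmod_iso (subquot (c k.+1) (c k)) X].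

Lemma nmulDl (x y z : R) : (x + y) ** z = x ** z + y ** z.
Proof. by rewrite -[x in LHS]scale1r nmulPl scale1r. Qed.

Lemma nmulDr (x y z : R) : z ** (x + y) = z ** x + z ** y.
Proof. by rewrite -[x in LHS]scale1r nmulPr scale1r. Qed.

Lemma nmulAr (x y z : R) : (x ** y) ** z = x ** (y ** z).
Proof. by rewrite nmulA. Qed.

Definition regular_module : lmodule R :=
  @LModule K R R (@nmul K R) nmulDl (fun r n p => nmulDr n p r) nmulAr.

Lemma principal_subproof (x : R) :
  is_submod (N := regular_module) [set r ** x | r in [set: R]].
Proof.
split=> /=.
- by exists 0 => //; apply: (@addrI R (0 ** x)); rewrite -nmulDl !addr0.
- move=> _ _ [r _ <-] [s _ <-]; exists (r - s) => //.
  by rewrite addrC -scaleN1r nmulPl scaleN1r addrC.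
- by move=> s _ [r _ <-]; exists (s ** r) => //; rewrite -nmulA.
Qed.

Definition principal (x : R) : lmodule R :=
  sub_module (Submod (principal_subproof x)).

End Modules.

Definition ksubmod (K : comPzRingType) (V : lmodType K) (S : set V) :=
  S 0 /\ forall (a : K) x y, S x -> S y -> S (a *: x + y).

(* [S] is a K-submodule of [V]; [c] is a composition series of [S]. *)
Definition finite_length (K : comPzRingType) (V : lmodType K) (S : set V) :=
  exists n (c : nat -> set V),
    [/\ c 0%N = [set 0], c n = S, (forall k, (k <= n)%N -> ksubmod (c k))
      & forall k, (k < n)%N -> c k `<` c k.+1 /\
          forall D, ksubmod D -> c k `<=` D -> D `<=` c k.+1 ->
            D = c k \/ D = c k.+1].

(* Intended for a family of subgroups [S i] of [V]. *)
Definition internal_dsum (V : zmodType) (I : Type) (S : I -> set V) :=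
  (forall x : V, exists n (s : 'I_n -> I) (y : 'I_n -> V),
     (forall k, S (s k) (y k)) /\ x = \sum_k y k) /\
  (forall n (s : 'I_n -> I) (y : 'I_n -> V), injective s ->
     (forall k, S (s k) (y k)) -> \sum_k y k = 0 -> forall k, y k = 0).

Section EnoughIdempotents.
Variables (K : comPzRingType) (R : nalg K) (I : Type) (e : I -> R).

Definition idempotent_elt (x : R) := x ** x = x.

Definition primitive (x : R) :=
  [/\ idempotent_elt x, x <> 0 &
    forall y z, idempotent_elt y -> idempotent_elt z ->
      y ** z = 0 -> z ** y = 0 -> x = y + z -> y = 0 \/ z = 0].

Definition enough_idempotents :=
  [/\ forall i, idempotent_elt (e i),
      forall i j, i <> j -> e i ** e j = 0,
      internal_dsum (fun i => [set e i ** r | r in [set: R]]) &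
      internal_dsum (fun i => [set r ** e i | r in [set: R]])].

Definition basic :=
  [/\ enough_idempotents,
      forall i j, finite_length [set e j ** r ** e i | r in [set: R]],
      forall i, primitive (e i) &
      forall i j, e i <> e j -> ~ lmod_iso (principal (e i)) (principal (e j))].

(* Ordinals are represented by well-ordered sets: [W] with the reflexive order
   [le] stands for [0,alpha). *)
Definition slt (W : Type) (le : rel W) (x y : W) := le x y && ~~ le y x.

Variables (W : Type) (le : rel W) (A : W -> set I).

Definition Pbar (j : W) : lmodule R :=
  dsum (fun r : {r | A j r} => principal (e (sval r))).

Definition Pbelow (i : W) : lmodule R :=
  dsum (fun j : {j | slt le j i} => Pbar (sval j)).

Definition TrP (i : W) (t : I) : submod (principal (e t)) :=
  trace (Pbelow i) (principal (e t)).

Definition Delta (i : W) (t : I) : lmodule R := quot_module (TrP i t).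

Definition Delta_level (i : W) (X : lmodule R) := exists2 t, A i t & X = Delta i t.

Definition Delta_below (i : W) (X : lmodule R) :=
  exists2 j, slt le j i & Delta_level j X.

Definition Delta_all (X : lmodule R) := exists i, Delta_level i X.

(* Only meaningful when [e] is basic and [A] is a partition of [I]; neither is
   part of the predicate. *)
Definition standardly_stratified :=
  forall i t, A i t -> Ff (Delta_below i) (sub_module (TrP i t)).

End EnoughIdempotents.

(* The axioms [lactPl] to [ractPr] express that both actions are biadditive and
   that K acts centrally. *)
Record bimodule (K : comPzRingType) (U T : nalg K) := Bimodule {
  bm_sort :> lmodType K;
  lact : U -> bm_sort -> bm_sort;
  ract : bm_sort -> T -> bm_sort;
  lactPl : forall (a : K) u v m, lact (a *: u + v) m = a *: lact u m + lact v m;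
  lactPr : forall (a : K) u m n, lact u (a *: m + n) = a *: lact u m + lact u n;
  ractPl : forall (a : K) m n t, ract (a *: m + n) t = a *: ract m t + ract n t;
  ractPr : forall (a : K) m s t, ract m (a *: s + t) = a *: ract m s + ract m t;
  lactM : forall u v m, lact (u ** v) m = lact u (lact v m);
  ractM : forall m s t, ract m (s ** t) = ract (ract m s) t;
  lractA : forall u m t, ract (lact u m) t = lact u (ract m t) }.

Section Bimodules.
Variables (K : comPzRingType) (U T : nalg K) (M : bimodule U T).

Lemma lactDl (u v : U) (m : M) : lact (u + v) m = lact u m + lact v m.
Proof. by rewrite -[u in LHS]scale1r lactPl scale1r. Qed.

Lemma lactDr (u : U) (m n : M) : lact u (m + n) = lact u m + lact u n.
Proof. by rewrite -[m in LHS]scale1r lactPr scale1r. Qed.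

Definition left_module : lmodule U :=
  LModule lactDl lactDr (@lactM K U T M).

Definition unitary_bimodule :=
  unitary left_module /\
  forall m : M, exists p (y : 'I_p -> M) (t : 'I_p -> T),
    m = \sum_k ract (y k) (t k).

Lemma column_subproof (t : T) :
  is_submod (N := left_module) [set ract m t | m in [set: M]].
Proof.
have rB (m n : M) : ract (m - n) t = ract m t - ract n t.
  by rewrite addrC -scaleN1r ractPl scaleN1r addrC.
split=> /=.
- by exists 0 => //; rewrite -(subrr 0) rB !subrr.
- by move=> _ _ [m _ <-] [n _ <-]; exists (m - n).
- by move=> u _ [m _ <-]; exists (lact u m) => //; rewrite lractA.
Qed.

Definition column (t : T) : lmodule U :=
  sub_module (Submod (column_subproof t)).

(* The triple (t, m, u) is the matrix [t 0; m u]. *)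
Definition tri_sort : lmodType K := (T * M * U)%type.

Definition tri_mul (x y : tri_sort) : tri_sort :=
  (x.1.1 ** y.1.1, ract x.1.2 y.1.1 + lact x.2 y.1.2, x.2 ** y.2).

Lemma tri_mulA (x y z : tri_sort) :
  tri_mul x (tri_mul y z) = tri_mul (tri_mul x y) z.
Proof.
case: x y z => [[t m] u] [[t' m'] u'] [[t'' m''] u'']; rewrite /tri_mul /=.
congr (_, _, _); rewrite ?nmulA //.
rewrite -[ract m t' in RHS]scale1r ractPl scale1r.
by rewrite lactDr ractM lractA lactM addrA.
Qed.

Lemma tri_mulPl (a : K) (x y z : tri_sort) :
  tri_mul (a *: x + y) z = a *: tri_mul x z + tri_mul y z.
Proof.
case: x y z => [[t m] u] [[t' m'] u'] [[t'' m''] u''].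
congr (_, _, _) => /=; rewrite ?nmulPl //.
by rewrite ractPl lactPl scalerDr addrACA.
Qed.

Lemma tri_mulPr (a : K) (x y z : tri_sort) :
  tri_mul z (a *: x + y) = a *: tri_mul z x + tri_mul z y.
Proof.
case: x y z => [[t m] u] [[t' m'] u'] [[t'' m''] u''].
congr (_, _, _) => /=; rewrite ?nmulPr //.
by rewrite ractPr lactPr scalerDr addrACA.
Qed.

Definition triangular : nalg K := NAlg tri_mulA tri_mulPl tri_mulPr.

Definition tri_idem (I J : Type) (e : I -> U) (f : J -> T) (r : I + J) :
    triangular :=
  match r with inl i => (0, 0, e i) | inr j => (f j, 0, 0) end.

End Bimodules.

Section Joint.
Variables (I J W V : Type).

(* the ordinal sum: everything on the left precedes everything on the right *)
Definition joint_le (leW : rel W) (leV : rel V) : rel (W + V) := fun x y =>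
  match x, y with
  | inl x, inl y => leW x y
  | inl _, inr _ => true
  | inr _, inl _ => false
  | inr x, inr y => leV x y
  end.

Definition joint_partition (A : W -> set I) (B : V -> set J) (x : W + V) :
    set (I + J) :=
  match x with inl i => inl @` A i | inr j => inr @` B j end.
End Joint.

(* Main.v *)
Require Import Defs.
From mathcomp Require Import all_boot all_order all_algebra.
From mathcomp Require Import boolp classical_sets functions cardinality wochoice.

Set Implicit Arguments.
Unset Strict Implicit.
Unset Printing Implicit Defensive.

Import GRing.Theory.
Local Open Scope classical_set_scope.
Local Open Scope ring_scope.
Local Open Scope nalg_scope.

(** For t in A_i the trace defining Delta_t(i) is the sum of the R e_t' R e_t with
    t' in an earlier layer.  Over Lambda, write (t, m, u) for the matrix with
    rows (t 0) and (m u).  At an index coming from I the trace is (0, 0, X) with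
    X the trace over U, so the standard modules there are those of U; at an index
    s coming from J, where every layer of I is earlier and UM = M, it is
    (Y, M f_s, 0) with Y the trace over T, so the standard modules there are
    those of T.  Filtrations of M f_s over U and of Y over T splice into one of
    (Y, M f_s, 0).  Conversely, cut a filtration of (Y, M f_s, 0) along the
    submodule (0, M f_s, 0), which is the part on which U acts unitally: each
    factor survives entirely either in the submodule or in the quotient. *)

(** * Submodules as subsets: differences, intersections and sums *)

Section Submodules.
Context (K : comPzRingType) (R : nalg K) (N : lmodule R).
Implicit Types S : set N.

Lemma is_submod0 S : is_submod S -> S 0.
Proof. by case. Qed.

Lemma is_submodB S x y : is_submod S -> S x -> S y -> S (x - y).
Proof. by case=> _ SB _; apply: SB. Qed.

Lemma is_submodN S x : is_submod S -> S x -> S (- x).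
Proof. by move=> SS Sx; rewrite -sub0r; apply: is_submodB (is_submod0 SS) Sx. Qed.

Lemma is_submodD S x y : is_submod S -> S x -> S y -> S (x + y).
Proof.
by move=> SS Sx Sy; rewrite -[y]opprK; apply: is_submodB Sx (is_submodN SS Sy).
Qed.

Lemma is_submodM S r x : is_submod S -> S x -> S (act r x).
Proof. by case=> _ _ SM; apply: SM. Qed.

Lemma is_submod_zero : is_submod [set 0 : N].
Proof. by split=> //= [x y -> ->|r x ->]; rewrite ?subrr ?act0. Qed.

Lemma is_submodI S S' : is_submod S -> is_submod S' -> is_submod (S `&` S').
Proof.
move=> [S0 SB SM] [S0' SB' SM']; split=> [|x y [? ?] [? ?]|r x [? ?]] //.
  by split; [apply: SB|apply: SB'].
by split; [apply: SM|apply: SM'].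
Qed.

Definition sumset S S' : set N := [set z | exists x y, [/\ S x, S' y & z = x + y]].

Lemma is_submod_sumset S S' :
  is_submod S -> is_submod S' -> is_submod (sumset S S').
Proof.
move=> SS SS'; split.
- by exists 0, 0; rewrite addr0; split=> //; apply: is_submod0.
- move=> _ _ [x [x' [Sx Sx' ->]]] [y [y' [Sy Sy' ->]]].
  exists (x - y), (x' - y'); split; [exact: is_submodB|exact: is_submodB|].
  by rewrite opprD addrACA.
- move=> r _ [x [y [Sx Sy ->]]]; exists (act r x), (act r y).
  by split; [exact: is_submodM|exact: is_submodM|rewrite actDr].
Qed.

Lemma sumsetl S S' : is_submod S' -> S `<=` sumset S S'.
Proof. by move=> /is_submod0 S0 x Sx; exists x, 0; rewrite addr0. Qed.

Lemma sumsetr S S' : is_submod S -> S' `<=` sumset S S'.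
Proof. by move=> /is_submod0 S0 x Sx; exists 0, x; rewrite add0r. Qed.

End Submodules.

(** * Isomorphisms of subquotients as additive relations *)

(* [corr k D1 B1 D2 B2]: the subquotients D1 / B1 and D2 / B2 are isomorphic,
   semilinearly along the ring relation [k].  The isomorphism is encoded by its
   graph, an additive relation as in Goursat's lemma, which makes the notion
   symmetric and avoids forming subquotients. *)
Definition corr (K1 K2 : comPzRingType) (R1 : nalg K1) (R2 : nalg K2)
    (k : R1 -> R2 -> Prop) (N1 : lmodule R1) (N2 : lmodule R2)
    (D1 B1 : set N1) (D2 B2 : set N2) :=
  exists rho : N1 -> N2 -> Prop,
  [/\ forall x y x' y', rho x y -> rho x' y' -> rho (x - x') (y - y'),
      forall r s x y, k r s -> rho x y -> rho (act r x) (act s y),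
      forall x, D1 x <-> exists y, rho x y,
      forall y, D2 y <-> exists x, rho x y &
      (forall x, B1 x <-> rho x 0) /\ (forall y, B2 y <-> rho 0 y)].

Section Correspondences.
Context (K : comPzRingType).

Lemma corr_sym (R1 R2 : nalg K) (k : R1 -> R2 -> Prop)
    (N1 : lmodule R1) (N2 : lmodule R2) (D1 B1 : set N1) (D2 B2 : set N2) :
  corr k D1 B1 D2 B2 -> corr (fun s r => k r s) D2 B2 D1 B1.
Proof.
move=> [rho [rB rM rd rr [rk1 rk2]]]; exists (fun y x => rho x y).
split=> //; first by move=> x y x' y'; apply: rB.
by move=> r s x y krs; apply: rM.
Qed.

(** The graph is the relational composite, which works because both relations share the middle
    numerator [D2] and denominator [B2]. The premise on [k13] lets a pair of scalars act through an
    intermediate one. *)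
Lemma corr_trans (R1 R2 R3 : nalg K) (k12 : R1 -> R2 -> Prop)
    (k23 : R2 -> R3 -> Prop) (k13 : R1 -> R3 -> Prop)
    (N1 : lmodule R1) (N2 : lmodule R2) (N3 : lmodule R3)
    (D1 B1 : set N1) (D2 B2 : set N2) (D3 B3 : set N3) :
  (forall r t, k13 r t -> exists2 s, k12 r s & k23 s t) ->
  corr k12 D1 B1 D2 B2 -> corr k23 D2 B2 D3 B3 -> corr k13 D1 B1 D3 B3.
Proof.
move=> k123 [rho [rB rM rd rr [rk1 rk2]]] [tau [tB tM td tr [tk1 tk2]]].
exists (fun x z => exists2 y, rho x y & tau y z).
split.
- move=> x z x' z' [y xy yz] [y' xy' yz']; exists (y - y').
    exact: rB.
  exact: tB.
- move=> r t x z /k123[s rs st] [y xy yz]; exists (act s y); first exact: rM.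
  exact: tM.
- move=> x; split=> [/rd[y xy]|[z [y xy yz]]]; last by apply/rd; exists y.
  have /td[z yz] : D2 y by apply/rr; exists x.
  by exists z, y.
- move=> z; split=> [/tr[y yz]|[x [y xy yz]]]; last by apply/tr; exists y.
  have /rr[x xy] : D2 y by apply/td; exists z.
  by exists x, y.
split=> [x|z].
- split=> [/rk1 x0|[y xy /tk1/rk2 ry]].
    (* [tau 0 0] arises by subtracting from itself a pair of [tau] over [0]; such a pair exists
       because [0] lies in [D2]. *)
    exists 0 => //; have := tB _ _ _ _.
    have /td[z xz] : D2 0 by apply/rr; exists x.
    by move=> /(_ _ _ _ _ xz xz); rewrite !subrr.
  by apply/rk1; have := rB _ _ _ _ xy ry; rewrite subr0 subrr.
- split=> [/tk2 z0|[y /rk2/tk1 ty yz]].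
    exists 0 => //; have := rB _ _ _ _.
    have /rr[x xz] : D2 0 by apply/td; exists z.
    by move=> /(_ _ _ _ _ xz xz); rewrite !subrr.
  by apply/tk2; have := tB _ _ _ _ yz ty; rewrite subr0 subrr.
Qed.

Lemma corr_trans_eq (R : nalg K) (N1 N2 N3 : lmodule R)
    (D1 B1 : set N1) (D2 B2 : set N2) (D3 B3 : set N3) :
  corr eq D1 B1 D2 B2 -> corr eq D2 B2 D3 B3 -> corr eq D1 B1 D3 B3.
Proof. by apply: corr_trans => r s ->; exists s. Qed.

Lemma corr_sym_eq (R : nalg K) (N1 N2 : lmodule R)
    (D1 B1 : set N1) (D2 B2 : set N2) :
  corr eq D1 B1 D2 B2 -> corr eq D2 B2 D1 B1.
Proof.
move=> /corr_sym[rho [rB rM rd rr rk]]; exists rho; split=> // r s x y rs.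
by apply: rM.
Qed.

(** The graph relates [x] to every [y] congruent to [phi x] modulo [B2]. Semilinearity is asked only
    on [D1], since a matrix entry may respect the action only on a submodule. *)
Lemma corr_fun (R1 R2 : nalg K) (k : R1 -> R2 -> Prop)
    (N1 : lmodule R1) (N2 : lmodule R2) (phi : N1 -> N2)
    (D1 B1 : set N1) (D2 B2 : set N2) :
  is_submod D1 -> is_submod D2 -> is_submod B2 -> B1 `<=` D1 -> B2 `<=` D2 ->
  (forall x y, phi (x - y) = phi x - phi y) ->
  (forall r s x, k r s -> D1 x -> phi (act r x) = act s (phi x)) ->
  (forall x, D1 x -> D2 (phi x)) ->
  (forall y, D2 y -> exists2 x, D1 x & B2 (phi x - y)) ->
  (forall x, D1 x -> (B2 (phi x) <-> B1 x)) ->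
  corr k D1 B1 D2 B2.
Proof.
move=> sD1 sD2 sB2 BD1 BD2 phiB phiM phiD phiS phiK.
have phi0 : phi 0 = 0 by rewrite -(subrr 0) phiB subrr.
exists (fun x y => [/\ D1 x, D2 y & B2 (phi x - y)]); split.
- move=> x y x' y' [Dx Dy B] [Dx' Dy' B']; split; try exact: is_submodB.
  by rewrite phiB opprD addrACA -opprD; apply: is_submodB.
- move=> r s x y rs [Dx Dy B]; split; try exact: is_submodM.
  by rewrite (phiM _ _ _ rs Dx) -actB; apply: is_submodM.
- move=> x; split=> [Dx|[y []//]]; exists (phi x); rewrite subrr.
  by split=> //; [apply: phiD|apply: is_submod0].
- by move=> y; split=> [/[dup] Dy /phiS[x Dx B]|[x []//]]; exists x.
split=> [x|y].
- split=> [Bx|[Dx _]].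
    split; [exact: BD1|exact: is_submod0|].
    by rewrite subr0; apply/phiK => //; apply: BD1.
  by rewrite subr0 => /(phiK _ Dx).
- rewrite phi0 sub0r; split=> [By|[_ _ /(is_submodN sB2)]]; last by rewrite opprK.
  by split; [exact: is_submod0|exact: BD2|exact: is_submodN].
Qed.

Lemma corr_sub_module (R : nalg K) (N : lmodule R) (S : submod N)
    (D : set N) (B : set (sub_module S)) :
  is_submod D -> D `<=` sm_set S -> (forall x, D (sm_val x) <-> B x) ->
  corr eq B [set 0] D [set 0].
Proof.
move=> sD DS DB.
have sB : is_submod B.
  by split=> [|x y /DB Bx /DB By|r x /DB Bx]; apply/DB;
     [exact: is_submod0|exact: is_submodB|exact: is_submodM].
apply: (corr_fun (phi := (@sm_val _ _ _ S : sub_module S -> N))) => //.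
- exact: is_submod_zero.
- by move=> _ /= ->; exact: (is_submod0 sB).
- by move=> _ /= ->; exact: (is_submod0 sD).
- by move=> r _ x <-.
- by move=> x /DB.
- move=> y Dy; have Sy : y \in sm_pred S by apply/asboolP; apply: DS.
  by exists (SmType Sy); [apply/DB|rewrite /= subrr].
- by move=> x _ /=; split=> [x0|->//]; apply: val_inj.
Qed.

Lemma corr_quot_module (R : nalg K) (N : lmodule R) (S : submod N) :
  corr eq [set: N] (sm_set S) [set: quot_module S] [set 0].
Proof.
apply: (corr_fun (phi := fun x : N => \pi_(Quotient.quot (sm_pred S))%qT x
  : quot_module S)) => //.
- exact: is_submod_zero.
- by move=> x y; apply: raddfB.
- by move=> r _ x <- _; rewrite /= quot_act_pi.
- by move=> y _; exists (repr y) => //=; rewrite reprK subrr.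
- move=> x _; rewrite -[X in [set X] _](raddf0 (\pi_(Quotient.quot (sm_pred S))%qT)) /=.
  split=> [/eqP|Sx].
    by rewrite -Quotient.idealrBE subr0 => /asboolP.
  by apply/eqP; rewrite -Quotient.idealrBE subr0; apply/asboolP.
Qed.

(** With zero denominators, subtracting two pairs that share a coordinate shows the relation to be
    functional in both directions; choice then extracts mutually inverse maps. *)
Lemma corr_iso (R : nalg K) (X Y : lmodule R) :
  lmod_iso X Y <-> corr eq [set: X] [set 0] [set: Y] [set 0].
Proof.
split=> [[h [[hB hM] [g gK hK]]]|[rho [rB rM rd rr [rk1 rk2]]]].
  apply: (corr_fun (phi := h)) => //.
  - exact: is_submod_zero.
  - by move=> r _ x <-.
  - by move=> y _; exists (g y) => //=; rewrite hK subrr.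
  - have h0 : h 0 = 0 by rewrite -(subrr 0) hB subrr.
    by move=> x _ /=; split=> [hx|->//]; apply: (can_inj gK); rewrite h0.
have [h hP] : {h : X -> Y & forall x, rho x (h x)}.
  by apply: (@choice X Y) => x; apply/rd.
have [g gP] : {g : Y -> X & forall y, rho (g y) y}.
  by apply: (@choice Y X (fun y x => rho x y)) => y; apply/rr.
have r1 x x' y : rho x y -> rho x' y -> x = x'.
  by move=> p q; apply/eqP; rewrite -subr_eq0; apply/eqP/rk1; rewrite -(subrr y);
     apply: rB.
have r2 x y y' : rho x y -> rho x y' -> y = y'.
  by move=> p q; apply/eqP; rewrite -subr_eq0; apply/eqP/rk2; rewrite -(subrr x);
     apply: rB.
exists h; split.
  split=> [x y|r x]; first by apply: r2 (hP _) (rB _ _ _ _ (hP x) (hP y)).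
  by apply: r2 (hP _) (rM _ _ _ _ erefl (hP x)).
exists g => [x|y]; first exact: r1 (gP _) (hP x).
exact: r2 (hP _) (gP y).
Qed.

Lemma corr_refl (R : nalg K) (X : lmodule R) :
  corr eq [set: X] [set 0] [set: X] [set 0].
Proof. by apply/corr_iso; exists id; split=> //; exists id. Qed.

Lemma corr_subquot (R : nalg K) (N : lmodule R) (D C : submod N) :
  sm_set C `<=` sm_set D ->
  corr eq (sm_set D) (sm_set C) [set: subquot D C] [set 0].
Proof.
move=> CD; apply: corr_trans_eq (corr_quot_module (restr_submod D C)).
apply: corr_sym_eq.
apply: (corr_fun (phi := (@sm_val _ _ _ D : sub_module D -> N))) => //.
- exact: submodP.
- exact: submodP.
- by move=> r _ x <-.
- by move=> x _; apply/asboolP; apply: sm_valP.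
- move=> y Dy; have Sy : y \in sm_pred D by apply/asboolP.
  by exists (SmType Sy) => //=; rewrite subrr; apply: is_submod0 (submodP C).
Qed.

End Correspondences.

(** * Finite filtrations as inductive chains *)

(** An arbitrary bottom [B] allows chains to be concatenated and cut, and [corr] allows factors to
    be tested without forming quotient modules. *)
Inductive filt (K : comPzRingType) (R : nalg K) (N : lmodule R)
    (Theta : lmodule R -> Prop) (B : set N) : set N -> Prop :=
| filt_refl : filt Theta B B
| filt_step C D X : filt Theta B C -> is_submod D -> C `<=` D -> Theta X ->
    corr eq D C [set: X] [set 0] -> filt Theta B D.

Section Filtrations.
Context (K : comPzRingType).

Lemma filt_sub (R : nalg K) (N : lmodule R) Theta (B D : set N) :
  filt Theta B D -> B `<=` D.
Proof. by elim=> // C E X _ BC _ CE _ _; apply: subset_trans CE. Qed.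

Lemma filt_submod (R : nalg K) (N : lmodule R) Theta (B D : set N) :
  is_submod B -> filt Theta B D -> is_submod D.
Proof. by move=> sB; elim. Qed.

Lemma filt_trans (R : nalg K) (N : lmodule R) Theta (B C D : set N) :
  filt Theta B C -> filt Theta C D -> filt Theta B D.
Proof.
by move=> BC; elim=> // E F X _ BE sF EF TX cX; apply: filt_step BE sF EF TX cX.
Qed.

Lemma filt_mono (R : nalg K) (N : lmodule R)
    (Theta Theta' : lmodule R -> Prop) (B D : set N) :
  (forall X, Theta X -> Theta' X) -> filt Theta B D -> filt Theta' B D.
Proof.
move=> TT; elim=> [|E F X _ BE sF EF TX cX]; first exact: filt_refl.
exact: filt_step BE sF EF (TT _ TX) cX.
Qed.

Lemma Ff_filt (R : nalg K) (N : lmodule R) (Theta : lmodule R -> Prop) :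
  Ff Theta N <-> unitary N /\ filt Theta [set 0 : N] [set: N].
Proof.
split=> [[uN [n [c [c0 cn cS]]]]|[uN fN]]; split=> //.
  suff fc k : (k <= n)%N -> filt Theta [set 0] (c k) by rewrite -cn; apply: fc.
  elim: k => [|k IHk] kn; first by rewrite c0; exact: filt_refl.
  have [cc [X TX isoX]] := cS _ kn.
  apply: (filt_step (IHk (ltnW kn)) (submodP _) cc TX).
  by apply: corr_trans_eq (corr_subquot cc) _; apply/corr_iso.
suff: exists n (c : nat -> submod N),
    [/\ sm_set (c 0%N) = [set 0], sm_set (c n) = [set: N]
      & forall k, (k < n)%N -> c k `<=` c k.+1 /\
          exists2 X, Theta X & lmod_iso (subquot (c k.+1) (c k)) X] by [].
elim: fN => [|C D X _ [n [c [c0 cn cS]]] sD CD TX cX].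
  by exists 0%N, (fun=> Submod (is_submod_zero N)).
exists n.+1, (fun k => if (k <= n)%N then c k else Submod sD).
split=> //=; first by rewrite ltnn.
move=> k; rewrite ltnS => kn1; rewrite kn1.
move: kn1; rewrite leq_eqVlt => /orP[/eqP ->|kn].
  rewrite ltnn cn; split=> //; exists X => //; apply/corr_iso.
  have CD' : sm_set (c n) `<=` sm_set (Submod sD) by rewrite cn.
  apply: corr_trans_eq (corr_sym_eq (corr_subquot CD')) _.
  by rewrite cn.
by rewrite kn; apply: cS.
Qed.

(** The correspondence theorem for a relation: since [C] contains the kernel [B1], taking images
    under [rho] does not change the factor [D / C]. *)
Lemma corr_image (R1 R2 : nalg K) (k : R1 -> R2 -> Prop)
    (N1 : lmodule R1) (N2 : lmodule R2) (D1 B1 C D : set N1)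
    (rho : N1 -> N2 -> Prop) :
  (forall x y x' y', rho x y -> rho x' y' -> rho (x - x') (y - y')) ->
  (forall r s x y, k r s -> rho x y -> rho (act r x) (act s y)) ->
  (forall x, D1 x <-> exists y, rho x y) ->
  (forall x, B1 x <-> rho x 0) ->
  is_submod C -> is_submod D -> B1 `<=` C -> C `<=` D -> D `<=` D1 ->
  corr k D C [set y | exists2 x, D x & rho x y] [set y | exists2 x, C x & rho x y].
Proof.
move=> rB rM rd rk sC sD BC CD DD.
have r0 : rho 0 0.
  have /DD/rd[y y0] : D 0 by apply: is_submod0.
  by have := rB _ _ _ _ y0 y0; rewrite !subrr.
(* The correction by an element of [C] makes [C] the denominator on the left and its image the
   denominator on the right. *)
exists (fun x y => D x /\ exists2 c, C c & rho (x - c) y); split.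
- move=> x y x' y' [Dx [c Cc xy]] [Dx' [c' Cc' xy']].
  split; first exact: is_submodB.
  exists (c - c'); first exact: is_submodB.
  by rewrite opprD addrACA -opprD; apply: rB.
- move=> r s x y rs [Dx [c Cc xy]]; split; first exact: is_submodM.
  by exists (act r c); [exact: is_submodM|rewrite -actB; apply: rM].
- move=> x; split=> [Dx|[y []//]]; have /rd[y xy] := DD _ Dx.
  by exists y; split=> //; exists 0; rewrite ?subr0 //; apply: is_submod0.
- move=> y /=; split=> [[x Dx xy]|[x [Dx [c Cc xy]]]].
    by exists x; split=> //; exists 0; rewrite ?subr0 //; apply: is_submod0.
  by exists (x - c) => //; apply: is_submodB => //; apply: CD.
split=> [x|y /=].
- split=> [Cx|[Dx [c Cc /rk/BC xc]]].
    by split; [exact: CD|exists x => //; rewrite subrr].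
  by rewrite -(subrK c x); apply: is_submodD.
- split=> [[x Cx xy]|[_ [c Cc]]].
    split; first exact: is_submod0.
    by exists (- x); [exact: is_submodN|rewrite sub0r opprK].
  by rewrite sub0r => cy; exists (- c) => //; apply: is_submodN.
Qed.

(** The new chain consists of the images of the old one under the relation. The totality of [k]
    makes these images stable under all of [R2]. *)
Lemma filt_corr (R1 R2 : nalg K) (k : R1 -> R2 -> Prop)
    (N1 : lmodule R1) (N2 : lmodule R2)
    (Theta1 : lmodule R1 -> Prop) (Theta2 : lmodule R2 -> Prop)
    (D1 B1 : set N1) (D2 B2 : set N2) :
  (forall s, exists r, k r s) ->
  (forall X1, Theta1 X1 -> exists2 X2, Theta2 X2 &
     corr k [set: X1] [set 0] [set: X2] [set 0]) ->
  is_submod B1 -> corr k D1 B1 D2 B2 ->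
  filt Theta1 B1 D1 -> filt Theta2 B2 D2.
Proof.
move=> ktot TT sB [rho [rB rM rd rr [rk1 rk2]]] fD.
pose im (D : set N1) := [set y | exists2 x, D x & rho x y].
have -> : D2 = im D1.
  apply/seteqP; split=> y /=; first by move=> /rr[x xy]; exists x => //; apply/rd; exists y.
  by move=> [x _ xy]; apply/rr; exists x.
have -> : B2 = im B1.
  apply/seteqP; split=> y /=.
    by move=> /rk2 y0; exists 0 => //; apply: is_submod0.
  move=> [x /rk1 x0 xy]; apply/rk2.
  by have := rB _ _ _ _ xy x0; rewrite subrr subr0.
have: D1 `<=` D1 by [].
rewrite -/(im D1).
(* The bound by [D1], the domain of [rho], has to accompany the induction. *)
suff H D : filt Theta1 B1 D -> D `<=` D1 -> filt Theta2 (im B1) (im D) by exact: H.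
elim=> [|C E X fC IH sE CE TX cX] ED; first exact: filt_refl.
have [X2 TX2 cX2] := TT _ TX.
have CD : C `<=` D1 by apply: subset_trans ED.
have cEC := corr_image rB rM rd rk1 (filt_submod sB fC) sE (filt_sub fC) CE ED.
apply: (filt_step (IH CD) _ _ TX2).
- split=> [|y y' [x Ex xy] [x' Ex' xy']|s y [x Ex xy]].
  + exists 0; first exact: is_submod0.
    have /ED/rd[y y0] : E 0 by apply: is_submod0.
    by have := rB _ _ _ _ y0 y0; rewrite !subrr.
  + by exists (x - x'); [exact: is_submodB|exact: rB].
  + by have [r rs] := ktot s; exists (act r x); [exact: is_submodM|exact: rM].
- by move=> y [x Cx xy]; exists x => //; apply: CE.
- have cEX := corr_trans (k13 := fun s r => k r s)
    (fun s r (rs : k r s) => ex_intro2 _ _ r rs erefl) (corr_sym cEC) cX.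
  (* Linearity over [R2] is recovered by passing to [R1] and back, as each [s] has some [r] with
     [k r s]. *)
  apply: corr_trans cEX cX2 => s _ <-.
  by have [r rs] := ktot s; exists r.
Qed.

(* Intersecting with [E] keeps the steps of the first kind and collapses those
   of the second; adding [E] does the opposite. *)
Lemma filt_split (R : nalg K) (N : lmodule R)
    (Theta Theta1 Theta2 : lmodule R -> Prop) (E F : set N) :
  is_submod E ->
  (forall C D X, is_submod C -> is_submod D -> C `<=` D -> D `<=` F -> Theta X ->
     corr eq D C [set: X] [set 0] ->
     (Theta1 X /\ D `<=` sumset C (D `&` E)) \/ (Theta2 X /\ D `&` E `<=` C)) ->
  forall D, D `<=` F -> filt Theta [set 0] D ->
  filt Theta1 [set 0] (D `&` E) /\ filt Theta2 E (sumset D E).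
Proof.
move=> sE alt D DF fD; elim: fD DF => [_|C {}D X fC IH sD CD TX cX DF].
  have -> : [set 0] `&` E = [set 0].
    by apply/seteqP; split=> [x []//|_ /= ->]; split=> //; apply: is_submod0.
  have -> : sumset [set 0] E = E.
    apply/seteqP; split=> [_ [_ [y [-> Ey ->]]]|x]; first by rewrite add0r.
    exact/sumsetr/is_submod_zero.
  by split; apply: filt_refl.
have sC : is_submod C by apply: filt_submod fC; apply: is_submod_zero.
have [fCE fCsE] := IH (subset_trans CD DF).
have sDE := is_submodI sD sE.
have sumCD : sumset C E `<=` sumset D E.
  by move=> _ [x [y [/CD Dx Ey ->]]]; exists x, y.
have [[TX1 DCE]|[TX2 DEC]] := alt _ _ _ sC sD CD DF TX cX; split.
(* Here [D] is the sum of [C] and [D & E], so by the second isomorphism theorem the inclusion of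
   [D & E] in [D] identifies the factor cut out by [E] with [D / C]. *)
- apply: (filt_step fCE sDE _ TX1); first by move=> x [/CD].
  apply: corr_trans_eq cX; apply: (corr_fun (phi := id)) => //.
  + by move=> x [/CD].
  + by move=> r _ x <-.
  + by move=> x [].
  + move=> _ /DCE[c [d [Cc Dd ->]]]; exists d => //.
    by rewrite opprD addrC subrK; apply: is_submodN.
  + by move=> x [_ Ex]; split=> [|[]].
- suff -> : sumset D E = sumset C E by [].
  apply/seteqP; split=> // _ [x [y [/DCE[c [d [Cc [_ Ed] ->]]] Ey ->]]].
  by exists c, (d + y); rewrite addrA; split=> //; apply: is_submodD.
- suff -> : D `&` E = C `&` E by [].
  apply/seteqP; split=> x [Dx Ex]; split=> //; [exact: DEC|exact: CD].
(* Here [D & E] lies in [C], so [D / C] maps isomorphically onto [(D + E) / (C + E)]: if [x = c + y]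
   with [x] in [D], then [y] lies in [D & E], hence in [C]. *)
- apply: (filt_step fCsE _ sumCD TX2); first exact: is_submod_sumset.
  apply: corr_trans_eq cX; apply: corr_sym_eq.
  apply: (corr_fun (phi := id)) => //.
  + exact: is_submod_sumset.
  + exact: is_submod_sumset.
  + by move=> r _ x <-.
  + exact: sumsetl.
  + move=> _ [x [y [Dx Ey ->]]]; exists x => //.
    rewrite opprD addrA subrr sub0r; apply: sumsetr => //.
    exact: is_submodN.
  + move=> x Dx; split=> [[c [y [Cc Ey xcy]]]|Cx]; last exact: sumsetl.
    rewrite xcy; apply: is_submodD => //; apply: DEC; split=> //.
    have -> : y = x - c by rewrite xcy addrC addKr.
    by apply: is_submodB => //; apply: CD.
Qed.

End Filtrations.

(** * Local units, and unitarity derived from them *)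

Section LocalUnits.
Context (K : comPzRingType).

Definition local_units (R : nalg K) := forall x : R, exists u : R, u ** x = x.

Lemma nmul0l (R : nalg K) (x : R) : 0 ** x = 0.
Proof. by apply: (@addrI R (0 ** x)); rewrite -nmulDl !addr0. Qed.

Lemma nmul0r (R : nalg K) (x : R) : x ** 0 = 0.
Proof. exact: (@act0 K R (regular_module R)). Qed.

Lemma nmulBr (R : nalg K) (x y z : R) : z ** (x - y) = z ** x - z ** y.
Proof. exact: (@actB K R (regular_module R)). Qed.

Lemma nmul_sumr (R : nalg K) n (x : R) (y : 'I_n -> R) :
  x ** (\sum_k y k) = \sum_k x ** y k.
Proof. exact: (@act_sum K R (regular_module R)). Qed.

Lemma nmulBl (R : nalg K) (x y z : R) : (x - y) ** z = x ** z - y ** z.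
Proof. by apply: (@addIr _ (y ** z)); rewrite -nmulDl !subrK. Qed.

Lemma act_subl (R : nalg K) (N : lmodule R) (r s : R) (x : N) :
  act (r - s) x = act r x - act s x.
Proof. by apply: (@addIr _ (act s x)); rewrite -actDl !subrK. Qed.

(** A finite sum of elements of the [e i R] is fixed by the sum of the distinct idempotents
    involved. *)
Lemma enough_idempotents_local_units (R : nalg K) (I : Type) (e : I -> R) :
  enough_idempotents e -> local_units R.
Proof.
move=> [ee eo [gen _] _] x.
have [n [s [y [sy ->]]]] := gen x.
(* The indices may repeat, and an idempotent must be counted once. The second clause, [u ** e i = 0]
   off the list, lets a new idempotent be added without spoiling the first. *)
have [u [us _]] : exists u : R, (forall k, u ** e (s k) = e (s k)) /\
    (forall i, (forall k, s k <> i) -> u ** e i = 0).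
  elim: n s {y sy} => [|n IHn] s.
    by exists 0; split=> [[]//|i _]; apply: nmul0l.
  have [u [us u0]] := IHn (fun k => s (lift ord0 k)).
  have [[k sk]|nsk] := pselect (exists k, s (lift ord0 k) = s ord0).
    exists u; split=> [l|i si]; last by apply: u0 => l; apply: si.
    by have [j ->|->] := unliftP ord0 l; [exact: us|rewrite -sk; apply: us].
  exists (u + e (s ord0)); split=> [l|i si]; rewrite nmulDl.
    have [j ->|->] := unliftP ord0 l.
      by rewrite us eo ?addr0 // => E; apply: nsk; exists j.
    by rewrite u0 ?add0r; [exact: ee|] => j E; apply: nsk; exists j.
  by rewrite u0 ?eo ?addr0 // => l; apply: si.
exists u; rewrite nmul_sumr; apply: eq_bigr => k _.
by have [r _ <-] := sy k; rewrite /= nmulA us.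
Qed.

(* If 1 - u1 kills z and 1 - u2 kills r - u1 r, then 1 - u := (1 - u2)(1 - u1)
   kills both z and r. *)
Lemma unitary_local_unit (R : nalg K) (N : lmodule R) (x : N) :
  local_units R -> unitary N -> exists u, act u x = x.
Proof.
move=> lu uN; have [n [r [y ->]]] := uN x.
elim: n r y => [|n IHn] r y; first by exists 0; rewrite big_ord0 act0.
rewrite big_ord_recr /=; set z := \sum_(i < n) _.
have [u1 u1z] : exists u, act u z = z by apply: IHn.
have [u2 u2r] := lu (r ord_max - u1 ** r ord_max).
exists (u1 + u2 - u2 ** u1); rewrite actDr.
congr (_ + _); first by rewrite act_subl actDl actM u1z addrK.
rewrite -actM; congr (act _ _).
move: u2r; rewrite nmulBr nmulA => u2r.
by rewrite nmulBl nmulDl -addrA u2r addrC subrK.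
Qed.

(** The hypothesis supplies the unitarity clause of [Ff]; the chains move along the identification
    of [sub_module S] with a subset of [N]. *)
Lemma Ff_sub_module (R : nalg K) (N : lmodule R) (S : submod N)
    (Theta : lmodule R -> Prop) :
  (forall x : N, sm_set S x -> exists u, act u x = x) ->
  Ff Theta (sub_module S) <-> filt Theta [set 0 : N] (sm_set S).
Proof.
move=> luS; rewrite Ff_filt.
have cS : corr eq [set: sub_module S] [set 0] (sm_set S) [set 0].
  apply: corr_sub_module => // [|x]; first exact: submodP.
  by split=> // _; apply/asboolP; apply: sm_valP.
have TT X1 : Theta X1 -> exists2 X2, Theta X2 &
    corr eq [set: X1] [set 0] [set: X2] [set 0].
  by move=> TX; exists X1 => //; apply: corr_refl.
have et (s : R) : exists r, r = s by exists s.
split=> [[_]|fS].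
  exact: filt_corr et TT (is_submod_zero _) cS.
split; last exact: filt_corr et TT (is_submod_zero _) (corr_sym_eq cS) fS.
move=> x; have [u ux] : exists u, act u (sm_val x) = sm_val x.
  by apply: luS; apply/asboolP; apply: sm_valP.
by exists 1%N, (fun=> u), (fun=> x); rewrite big_ord1; apply: val_inj.
Qed.

End LocalUnits.

(** * Injections into a direct sum and induction on its elements *)

Section DirectSums.
Context (K : comPzRingType) (R : nalg K) (X : Type) (F : X -> lmodule R).

(** The value at [x'] must have type [F x'], hence the transport along a classically decided
    equality. *)
Definition dsingle x (y : F x) : dprod_module F := fun x' =>
  match pselect (x = x') with
  | left E => eq_rect x (fun z => lm_sort (F z)) y x' E
  | right _ => 0
  end.

Lemma dsingle_diag x (y : F x) : dsingle y x = y.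
Proof.
by rewrite /dsingle; case: pselect => // E; rewrite (Prop_irrelevance E erefl).
Qed.

Lemma dsingle_off x (y : F x) x' : x <> x' -> dsingle y x' = 0.
Proof. by rewrite /dsingle; case: pselect. Qed.

Lemma dsingle_sub x (y y' : F x) x' :
  dsingle (y - y') x' = dsingle y x' - dsingle y' x'.
Proof.
by rewrite /dsingle; case: pselect => [E|_]; [case: x' / E|rewrite subr0].
Qed.

Lemma dsingle_act r x (y : F x) x' : dsingle (act r y) x' = act r (dsingle y x').
Proof. by rewrite /dsingle; case: pselect => [E|_]; [case: x' / E|rewrite act0]. Qed.

Lemma dinj_subproof x (y : F x) :
  dsingle y \in sm_pred (Submod (dsum_subproof F)).
Proof.
apply/asboolP; apply: (@sub_finite_set _ _ [set x]); last exact: finite_set1.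
by move=> x' /= nz; apply: contrapT => xx'; apply: nz; apply: dsingle_off => E;
   apply: xx'.
Qed.

Definition dinj x (y : F x) : dsum F := SmType (dinj_subproof y).

Lemma dinj_lhom x : lhom (@dinj x).
Proof.
split=> [y y'|r y]; apply: val_inj; apply: functional_extensionality_dep => x'.
  exact: dsingle_sub.
exact: dsingle_act.
Qed.

(** The support is finite, so an element is exhausted by subtracting one coordinate at a time. *)
Lemma dsum_ind (P : set (dsum F)) :
  is_submod P -> (forall x (y : F x), P (dinj y)) -> forall u, P u.
Proof.
move=> sP Pinj u.
have /asboolP/= := sm_valP u.
(* [{classic X}] equips the bare index type with the decidable equality needed to list the
   support. *)
move=> /(@finite_seqP {classic X})[s sE].
have {sE}: forall x : {classic X}, sm_val u x <> 0 -> x \in s.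
  move=> x ux; have : [set` s] x by rewrite -sE.
  by [].
elim: s u => [|x s IHs] u us.
  have -> : u = 0; last exact: is_submod0.
  apply: val_inj; apply: functional_extensionality_dep => x.
  by apply: contrapT => /us.
rewrite -(subrK (dinj (sm_val u x)) u); apply: is_submodD => //.
apply: IHs => x'.
have -> : sm_val (u - dinj (sm_val u x)) x' =
    sm_val u x' - dsingle (sm_val u x) x' by [].
have [<-|xx'] := pselect (x = x'); first by rewrite dsingle_diag subrr.
rewrite dsingle_off // subr0 => /us; rewrite inE => /orP[/eqP E|//].
by case: xx'.
Qed.

End DirectSums.

(** * Traces of projectives computed inside the algebra *)

Section Traces.
Context (K : comPzRingType) (R : nalg K) (I W : Type) (e : I -> R).
Context (le : rel W) (A : W -> set I).

Let layers (i : W) (j : {j | slt le j i}) : lmodule R := Pbar e A (sval j).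
Let layer (j : W) (s : {s | A j s}) : lmodule R := principal (e (sval s)).

(** The sum of the [R e_s R e_t] over all [s] in layers before [i], taken inside [R] itself, so that
    elements of the trace can be handled by induction without mentioning morphisms. *)
Inductive trgen (i : W) (t : I) : set R :=
| trgen0 : trgen i t 0
| trgenB x y : trgen i t x -> trgen i t y -> trgen i t (x - y)
| trgen_mul j s a b : slt le j i -> A j s -> trgen i t (a ** e s ** b ** e t).

Lemma is_submod_trgen i t : is_submod (N := regular_module R) (trgen i t).
Proof.
split=> [|x y|r x]; [exact: trgen0|exact: trgenB|].
elim=> [|{}x y _ IHx _ IHy|j s a b ji As] /=.
- by rewrite nmul0r; apply: trgen0.
- by rewrite nmulBr; apply: trgenB.
- by rewrite !nmulA; apply: trgen_mul ji As.
Qed.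

Lemma trgen_principal i t x : trgen i t x -> exists r, r ** e t = x.
Proof.
elim=> [|{}x y _ [r <-] _ [r' <-]|j s a b _ _].
- by exists 0; rewrite nmul0l.
- by exists (r - r'); rewrite nmulBl.
- by exists (a ** e s ** b).
Qed.

Hypothesis e_idem : forall i, idempotent_elt (e i).

(** A morphism from [R e_s] to [R e_t] is right multiplication by the image of [e_s], an element
    [b e_t]; so its values have the form [a e_s b e_t], and every such product occurs. *)
Lemma TrPE i t (x : principal (e t)) :
  sm_set (TrP e le A i t) x <-> trgen i t (sm_val x).
Proof.
have sT := is_submod_trgen i t.
split=> [[p [h [y [hh ->]]]]|].
  elim: p h y hh => [|p IHp] h y hh; first by rewrite big_ord0; apply: trgen0.
  rewrite big_ord_recr /=.
  pose wd (k : 'I_p) := widen_ord (leqnSn p) k.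
  apply: (is_submodD sT).
    by apply: (IHp (h \o wd) (y \o wd)) => k; apply: hh.
  have [hB hM] := hh ord_max.
  move: (h ord_max) (y ord_max) hB hM => {hh}g u gB gM.
  have g0 : g 0 = 0 by rewrite -(subrr 0) gB subrr.
  (* The claim is reduced to single summands by two nested inductions, over the layers and then
     inside a layer. *)
  pose P := [set u | trgen i t (sm_val (g u))].
  have sP : is_submod P.
    rewrite /P; split=> /= [|v w Pv Pw|r v Pv].
    - by rewrite g0; apply: trgen0.
    - by rewrite gB; apply: trgenB.
    - by rewrite gM; apply: (is_submodM r sT Pv).
  suff: P u by [].
  apply: (dsum_ind sP) => -[j ji] v.
  have [dB dM] := @dinj_lhom _ _ _ (@layers i) (exist _ j ji).
  apply: (dsum_ind (P := [set v | P (dinj v)])); last first.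
    move=> [s As] w; rewrite /P /=.
    have es : e s \in sm_pred (Submod (principal_subproof (e s))).
      by apply/asboolP; exists (e s) => //; apply: e_idem.
    have /asboolP[r _ rw] := sm_valP w.
    pose w0 : principal (e s) := SmType es.
    (* Idempotency provides a second factor [e s], which survives in the value once [g] sends [w0]
       to some [b ** e t]. *)
    have -> : w = act r (act (e s) w0).
      by apply: val_inj => /=; rewrite (e_idem s : _ ** _ = _).
    have [d'B d'M] := @dinj_lhom _ _ _ (@layer j) (exist _ s As).
    rewrite /= in d'M; rewrite d'M d'M dM dM gM gM.
    have /asboolP[b _ bE] := sm_valP
      (g (@dinj _ _ _ (@layers i) (exist _ j ji)
            (@dinj _ _ _ (@layer j) (exist _ s As) w0))).
    rewrite /= -bE !nmulA; exact: trgen_mul ji As.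
  have [P0 PB PM] := sP.
  split=> /= [|v1 v2 Pv1 Pv2|r v1 Pv1].
  - have -> : 0 = (0 : Pbar e A j) - 0 by rewrite subrr.
    by rewrite dB subrr.
  - by rewrite dB; apply: PB.
  - by rewrite dM; apply: PM.
move=> xT; have [x' Tx' xx'] : exists2 x' : principal (e t),
    sm_set (TrP e le A i t) x' & sm_val x' = sm_val x.
  elim: xT => [|z z' _ [x1 T1 <-] _ [x2 T2 <-]|j s a b ji As].
  - by exists 0 => //; apply: is_submod0 (submodP _).
  - by exists (x1 - x2) => //; apply: is_submodB (submodP _) T1 T2.
  (* The morphism realizing the generator: project to the coordinate [(j, s)], then multiply on the
     right by [b ** e t]. *)
  have hP (u : Pbelow e le A i) :
      sm_val (sm_val (sm_val u (exist _ j ji)) (exist _ s As)) ** b ** e t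
      \in sm_pred (Submod (principal_subproof (e t))).
    apply/asboolP.
    by exists (sm_val (sm_val (sm_val u (exist _ j ji)) (exist _ s As)) ** b).
  have aP : a ** e s \in sm_pred (Submod (principal_subproof (e s))).
    by apply/asboolP; exists a.
  pose y : Pbelow e le A i := @dinj _ _ _ (@layers i) (exist _ j ji)
    (@dinj _ _ _ (@layer j) (exist _ s As) (SmType aP)).
  exists (SmType (hP y)).
    exists 1%N, (fun _ u => SmType (hP u)), (fun=> y); split; last by rewrite big_ord1.
    move=> _; split=> [u v|r u]; apply: val_inj => /=.
      by rewrite -!nmulBl.
    by rewrite !nmulA.
  by rewrite /= dsingle_diag /= dsingle_diag.
by rewrite -(val_inj xx' : x' = x).
Qed.

Lemma corr_TrP i t :
  corr eq (sm_set (TrP e le A i t)) [set 0]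
    (trgen i t : set (regular_module R)) [set 0].
Proof.
apply: corr_sub_module; first exact: is_submod_trgen.
  by move=> x /trgen_principal[r <-]; exists r.
by move=> x; rewrite TrPE.
Qed.

(** Presents a standard module as a quotient of left ideals of [R], where elements can be computed
    with as matrices. *)
Lemma corr_Delta i t :
  corr eq [set: Delta e le A i t] [set 0]
    ([set r ** e t | r in [set: R]] : set (regular_module R)) (trgen i t).
Proof.
apply: corr_trans_eq (corr_sym_eq (corr_quot_module _)) _.
apply: (corr_fun (phi := (@sm_val _ _ _ _ : principal (e t) -> regular_module R))) => //.
- exact: principal_subproof.
- exact: is_submod_trgen.
- by move=> x /trgen_principal[r <-]; exists r.
- by move=> r _ x <-.
- by move=> x _; have /asboolP := sm_valP x.
- move=> y Dy; have Sy : y \in sm_pred (Submod (principal_subproof (e t))) by apply/asboolP.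
  by exists (SmType Sy) => //=; rewrite subrr; apply: trgen0.
- by move=> x _; rewrite TrPE.
Qed.

(** Local units make every submodule of the regular module unitary, so only the chains of left
    ideals remain. *)
Lemma standardly_stratifiedE : local_units R ->
  standardly_stratified e le A <->
  forall i t, A i t ->
    filt (Delta_below e le A i) [set 0 : regular_module R] (trgen i t).
Proof.
move=> lu.
have TT i X1 : Delta_below e le A i X1 -> exists2 X2, Delta_below e le A i X2 &
    corr eq [set: X1] [set 0] [set: X2] [set 0].
  by move=> TX; exists X1 => //; apply: corr_refl.
have et (s : R) : exists r, r = s by exists s.
have E i t : Ff (Delta_below e le A i) (sub_module (TrP e le A i t)) <->
    filt (Delta_below e le A i) [set 0 : regular_module R] (trgen i t).
  rewrite Ff_sub_module => [|x _].
    split; apply: filt_corr et (TT i) (is_submod_zero _) _; first exact: corr_TrP.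
    exact: corr_sym_eq (corr_TrP i t).
  have [u ux] := lu (sm_val x); exists u; exact: val_inj.
by split=> ss i t Ait; apply/E; apply: ss.
Qed.

End Traces.

(** * The triangular algebra and its local units *)

Section Triangular.
Context (K : comPzRingType) (U T : nalg K) (M : bimodule U T).
Notation L := (triangular M).

Lemma ractDl (m n : M) (t : T) : ract (m + n) t = ract m t + ract n t.
Proof. by rewrite -[m in LHS]scale1r ractPl scale1r. Qed.

Lemma ract0l (t : T) : ract (0 : M) t = 0.
Proof. by apply: (@addrI _ (ract (0 : M) t)); rewrite -ractDl !addr0. Qed.

Lemma ractBl (m n : M) (t : T) : ract (m - n) t = ract m t - ract n t.
Proof. by apply: (@addIr _ (ract n t)); rewrite -ractDl !subrK. Qed.

Lemma ract0r (m : M) : ract m 0 = 0.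
Proof.
by apply: (@addrI _ (ract m 0)); rewrite -[X in X + _]scale1r -ractPr scaler0 !addr0.
Qed.

Lemma lact0l (m : M) : lact 0 m = 0.
Proof. by apply: (@addrI _ (lact 0 m)); rewrite -lactDl !addr0. Qed.

Lemma lact0r (u : U) : lact u (0 : M) = 0.
Proof. exact: (@act0 K U (left_module M)). Qed.

Lemma lactBl (u v : U) (m : M) : lact (u - v) m = lact u m - lact v m.
Proof. exact: (@act_subl K U (left_module M)). Qed.

Definition tri (t : T) (m : M) (u : U) : L := (t, m, u).

Lemma triM t m u t' m' u' :
  tri t m u ** tri t' m' u' = tri (t ** t') (ract m t' + lact u m') (u ** u').
Proof. by []. Qed.

Lemma triB t m u t' m' u' :
  tri t m u - tri t' m' u' = tri (t - t') (m - m') (u - u').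
Proof. by []. Qed.

Lemma triP (x : L) : x = tri x.1.1 x.1.2 x.2.
Proof. by case: x => [[]]. Qed.

Definition triE := (triM, nmul0l, nmul0r, ract0l, ract0r, lact0l, lact0r,
  addr0, add0r).

(** One element of [U] has to fix both [m] and [u]; it is built by the same formula as in
    [unitary_local_unit]. *)
Lemma triangular_local_units :
  local_units U -> local_units T -> unitary (left_module M) -> local_units L.
Proof.
move=> luU luT uM x; rewrite (triP x); move: x.1.1 x.1.2 x.2 => t m u.
have [vt vtE] := luT t.
have [v1 v1E] : exists v, lact v m = m.
  exact: (unitary_local_unit (N := left_module M) m luU uM).
have [v2] := luU (u - v1 ** u).
rewrite nmulBr nmulA => v2E.
exists (tri vt 0 (v1 + v2 - v2 ** v1)); rewrite !triE vtE; congr tri.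
  by rewrite lactBl lactDl lactM v1E addrK.
by rewrite nmulBl nmulDl -addrA v2E addrC subrK.
Qed.

(** * Traces over the triangular algebra, entry by entry *)

Context (I J W V : Type) (e : I -> U) (f : J -> T).
Context (leW : rel W) (leV : rel V) (A : W -> set I) (B : V -> set J).
Notation g := (tri_idem M e f).
Notation leC := (joint_le leW leV).
Notation C := (joint_partition A B).

Lemma tri_idem_inl i : g (inl i) = tri 0 0 (e i). Proof. by []. Qed.

Lemma tri_idem_inr j : g (inr j) = tri (f j) 0 0. Proof. by []. Qed.

Let triEg := (tri_idem_inl, tri_idem_inr, triE).

Lemma tri_idem_idem : (forall i, idempotent_elt (e i)) ->
  (forall j, idempotent_elt (f j)) -> forall r, idempotent_elt (g r).
Proof.
move=> ee ff [i|j]; rewrite /idempotent_elt.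
  by rewrite !triEg (ee i : _ ** _ = _).
by rewrite !triEg (ff j : _ ** _ = _).
Qed.

(** No layer of [J] precedes one of [I], and right multiplication by [tri 0 0 (e t)] kills the first
    column. *)
Lemma trgen_inl w t (x : L) : trgen g leC C (inl w) (inl t) x <->
  [/\ x.1.1 = 0, x.1.2 = 0 & trgen e leW A w t x.2].
Proof.
split.
  elim=> [|{}x y _ [x1 x2 x3] _ [y1 y2 y3]|[j|j] s a b // ji [i Ai <-]].
  - by split=> //; apply: trgen0.
  - rewrite (triP x) (triP y) triB /= x1 x2 y1 y2 !subrr.
    by split=> //; apply: trgenB.
  - rewrite (triP a) (triP b) !triEg /=.
    by split=> //; apply: trgen_mul (ji : slt leW j w) Ai.
move=> [x1 x2 x3]; rewrite (triP x) x1 x2.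
elim: x3 => [|y z _ IHy _ IHz|j s a b ji As].
- exact: trgen0.
- have -> : tri 0 0 (y - z) = tri 0 0 y - tri 0 0 z by rewrite triB !subrr.
  exact: trgenB.
- have -> : tri 0 0 (a ** e s ** b ** e t) =
      tri 0 0 a ** g (inl s) ** tri 0 0 b ** g (inl t).
    by rewrite !triEg.
  by apply: (@trgen_mul _ _ _ _ _ _ _ _ _ (inl j)) => //; exists s.
Qed.

(** All layers of [I] come earlier, and their idempotents generate [U]; since [UM = M], they
    contribute the whole of [M f_s]. *)
Lemma trgen_inr v s (x : L) :
  enough_idempotents e -> unitary (left_module M) ->
  (forall i, exists w, A w i) ->
  trgen g leC C (inr v) (inr s) x <->
  [/\ trgen f leV B v s x.1.1, [set ract m (f s) | m in [set: M]] x.1.2 & x.2 = 0].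
Proof.
move=> [ee _ [gen _] _] uM Acov.
have sT : is_submod (N := regular_module L) (trgen g leC C (inr v) (inr s)).
  exact: is_submod_trgen.
split.
  elim=> [|{}x y _ [x1 [m _ x2] x3] _ [y1 [n _ y2] y3]|[j|j] r a b ji [i Ai <-]].
  - by split=> //; [exact: trgen0|exists 0 => //; rewrite ract0l].
  - rewrite (triP x) (triP y) triB /= x3 y3 subrr.
    split=> //; first exact: trgenB.
    by exists (m - n) => //; rewrite ractBl x2 y2.
  - rewrite (triP a) (triP b) !triEg /=.
    split=> //; first exact: trgen0.
    by eexists.
  - rewrite (triP a) (triP b) !triEg /=.
    split=> //; first exact: trgen_mul (ji : slt leV j v) Ai.
    by eexists.
move=> [x1 [m _ x2] x3]; rewrite (triP x) -x2 x3.
(* A difference rather than a sum, to match the constructor [trgenB]. *)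
have -> : tri x.1.1 (ract m (f s)) 0 = tri x.1.1 0 0 - tri 0 (- ract m (f s)) 0.
  by rewrite triB opprK !subr0 add0r.
apply: trgenB.
  elim: x1 => [|y z _ IHy _ IHz|j r a b ji Br].
  - exact: trgen0.
  - have -> : tri (y - z) 0 0 = tri y 0 0 - tri z 0 0 by rewrite triB !subrr.
    exact: trgenB.
  - have -> : tri (a ** f r ** b ** f s) 0 0 =
        tri a 0 0 ** g (inr r) ** tri b 0 0 ** g (inr s).
      by rewrite !triEg.
    by apply: (@trgen_mul _ _ _ _ _ _ _ _ _ (inr j)) => //; exists r.
have -> : tri 0 (- ract m (f s)) 0 = - tri 0 (ract m (f s)) 0.
  by rewrite -[RHS]sub0r -[X in _ = X - _]/(tri 0 0 0) triB !subrr sub0r.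
apply: (is_submodN sT).
pose P := [set m : left_module M | trgen g leC C (inr v) (inr s) (tri 0 (ract m (f s)) 0)].
have P0 : P 0 by rewrite /P /= ract0l; apply: trgen0.
have PD m1 m2 : P m1 -> P m2 -> P (m1 + m2).
  rewrite /P /= ractDl.
  have -> : tri 0 (ract m1 (f s) + ract m2 (f s)) 0 =
     tri 0 (ract m1 (f s)) 0 + tri 0 (ract m2 (f s)) 0 :> L.
    by congr (_, _, _); rewrite addr0.
  exact: (is_submodD sT).
(* Unitarity writes [m] as a sum of elements [r n], and each [r] is a sum of elements of the
   [e i U]. *)
suff Pe i (r : U) (n : M) : P (lact (e i ** r) n).
  suff: P m by [].
  have [p [r [y ->]]] := uM m; apply: big_ind => // k _.
  have [q [i [z [zi ->]]]] := gen (r k).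
  have -> : act (\sum_l z l) (y k) = \sum_l act (z l) (y k) :> left_module M.
    by apply: (big_morph (fun r => act r (y k))) => [a b|]; [apply: actDl|apply: lact0l].
  by apply: big_ind => // l _; have [r' _ <-] := zi l; apply: Pe.
rewrite /P /= lactM lractA.
have -> : tri 0 (lact (e i) (ract (lact r n) (f s))) 0 =
   tri 0 0 (e i) ** g (inl i) ** tri 0 (lact r n) 0 ** g (inr s).
  by rewrite !triEg (ee i : _ ** _ = _) !lractA.
have [w Aw] := Acov i.
by apply: (@trgen_mul _ _ _ _ _ _ _ _ _ (inl w)) => //; exists i.
Qed.


(** * Comparison of modules along the projections to [U] and [T] *)

(** The diagonal entries are ring homomorphisms because the matrices are triangular; they are stated
    as relations to serve as the scalar relation of [corr]. *)
Definition projU (x : L) (u : U) := x.2 = u.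
Definition projT (x : L) (t : T) := x.1.1 = t.

Lemma projU_total u : exists x, projU x u.
Proof. by exists (tri 0 0 u). Qed.

Lemma projT_total t : exists x, projT x t.
Proof. by exists (tri t 0 0). Qed.

Lemma principal_inl (t : I) (x : L) : [set r ** g (inl t) | r in [set: L]] x <->
  [/\ x.1.1 = 0, x.1.2 = 0 & [set u ** e t | u in [set: U]] x.2].
Proof.
split=> [[r _ <-]|[x1 x2 [u _ x3]]].
  by rewrite (triP r) !triEg; split=> //=; eexists.
by exists (tri 0 0 u) => //; rewrite !triEg (triP x) x1 x2 x3.
Qed.

Lemma principal_inr (s : J) (x : L) : [set r ** g (inr s) | r in [set: L]] x <->
  [/\ [set r ** f s | r in [set: T]] x.1.1,
      [set ract m (f s) | m in [set: M]] x.1.2 & x.2 = 0].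
Proof.
split=> [[r _ <-]|[[t _ x1] [m _ x2] x3]].
  by rewrite (triP r) !triEg; split=> //=; eexists.
by exists (tri t m 0) => //; rewrite !triEg (triP x) x1 x2 x3.
Qed.

Definition bimod_part (s : J) : set (regular_module L) :=
  [set x : L | [/\ x.1.1 = 0, [set ract m (f s) | m in [set: M]] x.1.2 & x.2 = 0]].

Lemma is_submod_bimod_part s : is_submod (bimod_part s).
Proof.
split=> [|x y [x1 [m _ x2] x3] [y1 [n _ y2] y3]|r x [x1 [m _ x2] x3]].
- by split=> //; exists 0 => //; rewrite ract0l.
- rewrite (triP x) (triP y) triB x1 y1 x3 y3 !subrr; split=> //=.
  by exists (m - n) => //; rewrite ractBl x2 y2.
- rewrite -[act r x]/(r ** x) (triP r) (triP x) x1 x3 !triE; split=> //=.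
  by exists (lact r.2 m) => //; rewrite lractA x2.
Qed.

(** The [T] entry vanishes on [bimod_part s], so a matrix acts there through its [U] entry alone. *)
Lemma corr_column s :
  corr projU (bimod_part s) [set 0]
    ([set ract m (f s) | m in [set: M]] : set (left_module M)) [set 0].
Proof.
apply: (corr_fun (phi := fun x : regular_module L => x.1.2 : left_module M)) => //.
- exact: is_submod_bimod_part.
- exact: column_subproof.
- exact: is_submod_zero.
- by move=> _ /= ->; apply: is_submod0 (is_submod_bimod_part s).
- by move=> _ /= ->; apply: is_submod0 (column_subproof M (f s)).
- move=> r u x <- [x1 _ x3].
  by rewrite -[act r x]/(r ** x) (triP r) (triP x) x1 x3 !triE.
- by move=> x [].
- move=> m mM; exists (tri 0 m 0) => //=; exact: subrr.
- by move=> x [x1 x2 x3]; split=> [/= m0|-> //]; rewrite (triP x) x1 x3 m0.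
Qed.

Hypothesis e_enough : enough_idempotents e.
Hypothesis f_idem : forall j, idempotent_elt (f j).
Hypothesis M_unitary : unitary (left_module M).
Hypothesis A_cover : forall i, exists w, A w i.

Let e_idem : forall i, idempotent_elt (e i). Proof. by case: e_enough. Qed.
Let g_idem := tri_idem_idem e_idem f_idem.

Lemma corr_trgen_inl w t :
  corr projU (trgen g leC C (inl w) (inl t) : set (regular_module L)) [set 0]
    (trgen e leW A w t : set (regular_module U)) [set 0].
Proof.
apply: (corr_fun (phi := fun x : regular_module L => x.2 : regular_module U)) => //.
- exact: is_submod_trgen.
- exact: is_submod_trgen.
- exact: is_submod_zero.
- by move=> _ /= ->; apply: trgen0.
- by move=> _ /= ->; apply: trgen0.
- by move=> r u x <-.
- by move=> x /trgen_inl[].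
- move=> u uT; exists (tri 0 0 u); last exact: subrr.
  by apply/trgen_inl; split.
- by move=> x /trgen_inl[x1 x2 _]; split=> [/= x3|-> //]; rewrite (triP x) x1 x2 x3.
Qed.

(** [bimod_part s] is exactly the kernel of the [T] entry on the trace. *)
Lemma corr_trgen_inr v s :
  corr projT (trgen g leC C (inr v) (inr s) : set (regular_module L)) (bimod_part s)
    (trgen f leV B v s : set (regular_module T)) [set 0].
Proof.
apply: (corr_fun (phi := fun x : regular_module L => x.1.1 : regular_module T)) => //.
- exact: is_submod_trgen.
- exact: is_submod_trgen.
- exact: is_submod_zero.
- move=> x [x1 x2 x3]; apply/trgen_inr => //; split=> //.
  by rewrite x1; apply: trgen0.
- by move=> _ /= ->; apply: trgen0.
- by move=> r u x <-.
- by move=> x /trgen_inr[].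
- move=> t tT; exists (tri t 0 0); last exact: subrr.
  by apply/trgen_inr => //; split=> //; exists 0 => //; apply: ract0l.
- by move=> x /trgen_inr[] // x1 x2 x3; split=> [/= x10|[]].
Qed.

Lemma corr_Delta_inl w t :
  corr projU [set: Delta g leC C (inl w) (inl t)] [set 0]
    [set: Delta e leW A w t] [set 0].
Proof.
apply: (corr_trans (k12 := eq) (k23 := projU))
    (corr_Delta leC C g_idem (inl w) (inl t)) _; last first.
  apply: (corr_trans (k12 := projU) (k23 := eq))
    (corr_sym_eq (corr_Delta leW A e_idem w t)); last first.
    apply: (corr_fun (phi := fun x : regular_module L => x.2 : regular_module U)) => //.
    - exact: principal_subproof.
    - exact: principal_subproof.
    - exact: is_submod_trgen.
    - by move=> x Bx; have [r <-] := trgen_principal Bx; exists r.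
    - by move=> x Bx; have [r <-] := trgen_principal Bx; exists r.
    - by move=> r u x <-.
    - by move=> x /principal_inl[].
    - move=> u uT; exists (tri 0 0 u); first by apply/principal_inl; split.
      by rewrite subrr; apply: trgen0.
    - move=> x /principal_inl[x1 x2 _].
      by split=> [x3|/trgen_inl[]//]; apply/trgen_inl; split.
  by move=> r u ru; exists u.
by move=> r u ru; exists r.
Qed.

(** The entries in [M f_s] fill both the projective and its trace, so they cancel in the
    quotient. *)
Lemma corr_Delta_inr v s :
  corr projT [set: Delta g leC C (inr v) (inr s)] [set 0]
    [set: Delta f leV B v s] [set 0].
Proof.
apply: (corr_trans (k12 := eq) (k23 := projT))
    (corr_Delta leC C g_idem (inr v) (inr s)) _; last first.
  apply: (corr_trans (k12 := projT) (k23 := eq))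
    (corr_sym_eq (corr_Delta leV B f_idem v s)); last first.
    apply: (corr_fun (phi := fun x : regular_module L => x.1.1 : regular_module T)) => //.
    - exact: principal_subproof.
    - exact: principal_subproof.
    - exact: is_submod_trgen.
    - by move=> x Bx; have [r <-] := trgen_principal Bx; exists r.
    - by move=> x Bx; have [r <-] := trgen_principal Bx; exists r.
    - by move=> r u x <-.
    - by move=> x /principal_inr[].
    - move=> t tT; exists (tri t 0 0).
        by apply/principal_inr; split=> //; exists 0 => //; apply: ract0l.
      by rewrite subrr; apply: trgen0.
    - move=> x /principal_inr[x1 x2 x3].
      by split=> [x4|/trgen_inr[]//]; apply/trgen_inr.
  by move=> r u ru; exists u.
by move=> r u ru; exists r.
Qed.

(** * Filtrations over the triangular algebra against those over [U] and [T] *)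

Lemma Delta_below_inl w (X : lmodule L) : Delta_below g leC C (inl w) X ->
  exists2 Y, Delta_below e leW A w Y & corr projU [set: X] [set 0] [set: Y] [set 0].
Proof.
move=> [[w'|//] lt [_ [t At <-] ->]]; exists (Delta e leW A w' t).
  by exists w' => //; exists t.
exact: corr_Delta_inl.
Qed.

Lemma Delta_below_inlV w (Y : lmodule U) : Delta_below e leW A w Y ->
  exists2 X, Delta_below g leC C (inl w) X &
    corr (fun u x => projU x u) [set: Y] [set 0] [set: X] [set 0].
Proof.
move=> [w' lt [t At ->]]; exists (Delta g leC C (inl w') (inl t)).
  by exists (inl w') => //; exists (inl t) => //; exists t.
exact/corr_sym/corr_Delta_inl.
Qed.

(** No bound is put on [w], because every layer of [I] precedes every layer of [J]; this is why all
    standard modules of [U] are allowed for the columns of [M]. *)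
Definition Delta_left (X : lmodule L) :=
  exists w t, A w t /\ X = Delta g leC C (inl w) (inl t).

Definition Delta_right v (X : lmodule L) :=
  exists v' t, [/\ slt leV v' v, B v' t & X = Delta g leC C (inr v') (inr t)].

Lemma Delta_below_inr v (X : lmodule L) :
  Delta_below g leC C (inr v) X <-> Delta_left X \/ Delta_right v X.
Proof.
split=> [[[w|v'] lt [_ [t At <-] ->]]|[[w [t [At ->]]]|[v' [t [lt At ->]]]]].
- by left; exists w, t.
- by right; exists v', t.
- by exists (inl w) => //; exists (inl t) => //; exists t.
- by exists (inr v') => //; exists (inr t) => //; exists t.
Qed.

(* Delta modules of the first kind are unital over U and those of the second
   kind are killed by U, while U maps the trace of the projective into M. *)
Lemma filt_trgen_inr v s : local_units U ->
  filt (Delta_below g leC C (inr v)) [set 0 : regular_module L]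
    (trgen g leC C (inr v) (inr s)) <->
  filt Delta_left [set 0 : regular_module L] (bimod_part s) /\
  filt (Delta_right v) (bimod_part s)
    (trgen g leC C (inr v) (inr s) : set (regular_module L)).
Proof.
move=> luU; set F : set (regular_module L) := trgen _ _ _ _ _.
have sF : is_submod F by apply: is_submod_trgen.
have sE := is_submod_bimod_part s.
have EF : bimod_part s `<=` F.
  by move=> x [x1 x2 x3]; apply/trgen_inr => //; split=> //; rewrite x1; apply: trgen0.
split; last first.
  move=> [f1 f2]; apply: filt_trans (filt_mono _ f1) (filt_mono _ f2).
    by move=> X TX; apply/Delta_below_inr; left.
  by move=> X TX; apply/Delta_below_inr; right.
move=> fF.
suff [] : filt Delta_left [set 0 : regular_module L] (F `&` bimod_part s) /\
    filt (Delta_right v) (bimod_part s) (sumset F (bimod_part s)).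
  have -> : F `&` bimod_part s = bimod_part s by apply/setIidPr.
  suff -> : sumset F (bimod_part s) = F by [].
  apply/seteqP; split; last exact: sumsetl.
  by move=> _ [x [y [Fx /EF Fy ->]]]; apply: is_submodD.
apply: (filt_split (F := F)) fF => //.
move=> C0 D X sC sD CD DF /Delta_below_inr[TX|TX] cX.
  (* If [b] fixes the [U] entry of the image [x] of [d], then [b d] lies in [bimod_part s] and has
     the same image, so [d - b d] falls into [C0]. *)
  left; split=> // d Dd.
  case: TX cX => w [t [At ->]] cX.
  have [rho [rB rM rd rr [rk1 rk2]]] :=
    corr_trans_eq cX (corr_Delta leC C g_idem (inl w) (inl t)).
  have /rd[x dx] := Dd.
  have /principal_inl[x1 x2 _] : [set r ** g (inl t) | r in [set: L]] x.
    by apply/rr; exists d.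
  have [b bx] := luU x.2.
  have zx : tri 0 0 b ** x = x by rewrite (triP x) x1 x2 !triE /= bx.
  pose zd : regular_module L := act (tri 0 0 b) d.
  exists (d - zd), zd; split; last by rewrite subrK.
    apply/rk1; rewrite -(subrr x); apply: (rB _ _ _ _ dx).
    by rewrite -[X in rho _ X]zx; exact: (rM (tri 0 0 b) _ _ _ erefl dx).
  split; first exact: is_submodM.
  have /trgen_inr[] // := DF _ Dd; move=> _ [m _ d2] d3.
  rewrite /zd -[act _ d]/(tri 0 0 b ** d) (triP d) -d2 d3 !triE; split=> //=.
  by exists (lact b m) => //; rewrite lractA.
(* Now [b] fixes [d], while [b x] lies in the trace that defines the standard module. The image of
   [d] is therefore zero and [d] belongs to [C0]. *)
right; split=> // d [Dd [d1 _ d3]].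
case: TX cX => v' [t [lt Bt ->]] cX.
have [rho [rB rM rd rr [rk1 rk2]]] :=
  corr_trans_eq cX (corr_Delta leC C g_idem (inr v') (inr t)).
have /rd[x dx] := Dd.
have /principal_inr[_ [m _ x2] x3] : [set r ** g (inr t) | r in [set: L]] x.
  by apply/rr; exists d.
have [b bd] := unitary_local_unit (N := left_module M) d.1.2 luU M_unitary.
have zd : tri 0 0 b ** d = d.
  by rewrite (triP d) d1 d3 !triE; congr tri; exact: bd.
have dzx : rho d (tri 0 0 b ** x).
  by rewrite -[X in rho X]zd; exact: (rM (tri 0 0 b) _ _ _ erefl dx).
have : rho 0 (tri 0 0 b ** x).
  apply/rk2/trgen_inr => //; rewrite (triP x) x3 !triE.
  split=> //=; first exact: trgen0.
  by exists (lact b m) => //; rewrite lractA x2.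
by move=> /(rB _ _ _ _ dzx); rewrite subr0 subrr => /rk1.
Qed.

Lemma filt_projU w t :
  filt (Delta_below g leC C (inl w)) [set 0 : regular_module L]
    (trgen g leC C (inl w) (inl t)) <->
  filt (Delta_below e leW A w) [set 0 : regular_module U] (trgen e leW A w t).
Proof.
have cwt := corr_trgen_inl w t.
split.
  apply: filt_corr (is_submod_zero _) cwt; first exact: projU_total.
  exact: Delta_below_inl.
apply: filt_corr (is_submod_zero _) (corr_sym cwt); first by move=> x; exists x.2.
exact: Delta_below_inlV.
Qed.

Lemma filt_projT v s :
  filt (Delta_right v) (bimod_part s)
    (trgen g leC C (inr v) (inr s) : set (regular_module L)) <->
  filt (Delta_below f leV B v) [set 0 : regular_module T] (trgen f leV B v s).
Proof.
have cvs := corr_trgen_inr v s.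
split.
  apply: filt_corr (is_submod_bimod_part s) cvs; first exact: projT_total.
  move=> _ [v' [t [lt Bt ->]]]; exists (Delta f leV B v' t).
    by exists v' => //; exists t.
  exact: corr_Delta_inr.
apply: filt_corr (is_submod_zero _) (corr_sym cvs); first by move=> x; exists x.1.1.
move=> _ [v' lt [t Bt ->]]; exists (Delta g leC C (inr v') (inr t)).
  by exists v', t.
exact/corr_sym/corr_Delta_inr.
Qed.

Lemma Ff_column s : local_units U ->
  filt Delta_left [set 0 : regular_module L] (bimod_part s) <->
  Ff (Delta_all e leW A) (column M (f s)).
Proof.
move=> luU; rewrite Ff_sub_module; last by move=> m _; apply: unitary_local_unit.
split.
  apply: filt_corr (is_submod_zero _) (corr_column s); first exact: projU_total.
  move=> _ [w [t [At ->]]]; exists (Delta e leW A w t); first by exists w, t.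
  exact: corr_Delta_inl.
apply: filt_corr (is_submod_zero _) (corr_sym (corr_column s)).
  by move=> x; exists x.2.
move=> _ [w [t At ->]]; exists (Delta g leC C (inl w) (inl t)); first by exists w, t.
exact/corr_sym/corr_Delta_inl.
Qed.

End Triangular.

Theorem theoremA (K : comPzRingType) (U T : nalg K) (I J : Type)
  (e : I -> U) (f : J -> T) (M : bimodule U T)
  (W V : Type) (leW : rel W) (leV : rel V)
  (A : W -> set I) (B : V -> set J)
  (I_nonempty : inhabited I) (J_nonempty : inhabited J)
  (U_basic : basic e) (T_basic : basic f)
  (M_unitary : unitary_bimodule M)
  (M_finite : forall i j,
    finite_length [set ract (lact (e i) m) (f j) | m in [set: M]])
  (W_wo : well_order leW) (V_wo : well_order leV)
  (A_partition : classical_sets.partition [set: W] A [set: I])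
  (B_partition : classical_sets.partition [set: V] B [set: J]) :
  standardly_stratified (tri_idem M e f)
    (joint_le leW leV) (joint_partition A B)
  <->
  (forall j, Ff (Delta_all e leW A) (column M (f j))) /\
  standardly_stratified f leV B /\ standardly_stratified e leW A.
Proof.
have [Ue _ _ _] := U_basic.
have [Te _ _ _] := T_basic.
have [uM _] := M_unitary.
have luU := enough_idempotents_local_units Ue.
have luT := enough_idempotents_local_units Te.
have luL := triangular_local_units luU luT uM.
have ee : forall i, idempotent_elt (e i) by case: Ue.
have ff : forall j, idempotent_elt (f j) by case: Te.
have [Ac _ _] := A_partition.
have Acov i : exists w, A w i.
  by have : [set: I] i by []; rewrite -Ac => -[w _ Aw]; exists w.
have Bcov j : exists v, B v j.
  have [Bc _ _] := B_partition.
  by have : [set: J] j by []; rewrite -Bc => -[v _ Bv]; exists v.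
have gg := tri_idem_idem M ee ff.
(* All three stratification conditions become filtrations of traces, so the indices from [I] and
   from [J] can be treated separately. *)
rewrite !standardly_stratifiedE //.
split=> [ss|[col [ssT ssU]] [w|v] _ [t At <-]].
(* An index from [J] yields two conditions at once, one on the column of [M] and one on the trace
   over [T]. *)
- have ssr v s : B v s -> Ff (Delta_all e leW A) (column M (f s)) /\
      filt (Delta_below f leV B v) [set 0 : regular_module T] (trgen f leV B v s).
    move=> Bs; have /filt_trgen_inr[] // := ss (inr v) (inr s) (imageP inr Bs).
    by move=> /Ff_column cs /filt_projT ts; split; [exact: cs|exact: ts].
  split=> [j|]; last split=> [v s Bs|w t At].
  + by have [v Bv] := Bcov j; case: (ssr v j Bv).
  + by case: (ssr v s Bs).
  + by have /filt_projU := ss (inl w) (inl t) (imageP inl At); apply.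
- by apply/filt_projU => //; apply: ssU.
- apply/filt_trgen_inr => //; split; first exact/Ff_column.
  by apply/filt_projT => //; apply: ssT.
Qed.
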